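(* Let $l\ge2$ be an integer, let $w\ge 2$ be an even integer, let $u=(1,1,\dots,1)\in\mathbf R^w$ (row vector) and $\rho=\left\lfloor\frac{l-1}{2}\right\rfloor$. Then: (i) the number of brick-wall lattice paths of the first type is $\mathcal B^{(1)}_{l,w}=u\,b^{(1)}_{l-1}$, where $$b^{(1)}_{l-1}=\begin{cases}(M_+M_-)^{\rho}\,b_0, & l\text{ odd},\\ M_-(M_+M_-)^{\rho}\,b_0, & l\text{ even};\end{cases}$$ (ii) the number of brick-wall lattice paths of the second type is $\mathcal B^{(2)}_{l,w}=u\,b^{(2)}_{l-1}$, where $$b^{(2)}_{l-1}=\begin{cases}(M_-M_+)^{\rho}\,b_0, & l\text{ odd},\\ M_+(M_-M_+)^{\rho}\,b_0, & l\text{ even}.\end{cases}$$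
   Context: A point $(a,b)\in\mathbf Z\times\mathbf Z$ is even (odd) if $|a|+|b|$ is even (odd). A brick-wall lattice path of the first type is a finite sequence of points of $\mathbf Z\times\mathbf Z$ in which each consecutive step is either the horizontal step $(1,0)$ (allowed from any point), or the step $(0,1)$ taken from an even point, or the step $(0,-1)$ taken from an odd point. A brick-wall lattice path of the second type is defined in the same way with the steps $(1,0)$ from any point, $(0,1)$ from an odd point, $(0,-1)$ from an even point. Paths visit no point more than once; the empty path (a single point) is allowed. Let $\mathcal R=[0,l-1]\times[0,w-1]$. For $t\in\{1,2\}$, $\mathcal B^{(t)}_{l,w}$ is the number of brick-wall lattice paths of type $t$ (type 1 = first, type 2 = second) starting at some point $(0,\alpha)$ and ending at some point $(l-1,\beta)$, with $\alpha,\beta\in\{0,\dots,w-1\}$, staying inside $\mathcal R$ and using no vertical step along the left side $x=0$ (vertical steps along the right side $x=l-1$ are allowed). For $0\le i\le l-1$, $0\le j\le w-1$, $b^{(t)}_{ij}$ is the number of such paths of type $t$ (inside $\mathcal R$, starting on the left side, no vertical step along $x=0$) ending at $(i,j)$, and $b^{(t)}_i$ is the column vector $(b^{(t)}_{i,w-1},b^{(t)}_{i,w-2},\dots,b^{(t)}_{i,1},b^{(t)}_{i,0})^T$. In particular $b^{(1)}_0=b^{(2)}_0=b_0$ is the all-ones column vector. Let $J=\begin{pmatrix}1&1\\1&1\end{pmatrix}$. For even $w$, $M_-$ and $M_+$ are the $w\times w$ block-diagonal matrices $M_-=\mathrm{diag}(1,J,\dots,J,1)$ (with $(w-2)/2$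 blocks $J$ and $1\times1$ blocks $(1)$ at both ends) and $M_+=\mathrm{diag}(J,J,\dots,J)$ (with $w/2$ blocks $J$). *)

(* Defs.v *)
From HB Require Import structures.
From mathcomp Require Import all_boot all_order all_algebra finmap.
From mathcomp Require Import boolp classical_sets functions cardinality reals.

Set Implicit Arguments.
Unset Strict Implicit.
Unset Printing Implicit Defensive.

Import Order.TTheory GRing.Theory Num.Theory.
Local Open Scope ring_scope.

Definition point := (int * int)%type.

Inductive path_type := FirstType | SecondType.

Definition even_point (p : point) : bool := ~~ odd (`|p.1| + `|p.2|)%N.
Definition odd_point (p : point) : bool := odd (`|p.1| + `|p.2|)%N.

Definition horizontal_step (p q : point) : bool := q == (p.1 + 1, p.2).

Definition vertical_step (t : path_type) (p q : point) : bool :=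
  match t with
  | FirstType => (even_point p && (q == (p.1, p.2 + 1)))
                 || (odd_point p && (q == (p.1, p.2 - 1)))
  | SecondType => (odd_point p && (q == (p.1, p.2 + 1)))
                  || (even_point p && (q == (p.1, p.2 - 1)))
  end.

Definition step (t : path_type) (p q : point) : bool :=
  horizontal_step p q || vertical_step t p q.

(* A path is the nonempty sequence of the points it visits, so [:: p] is the
   "empty path" at p. *)
Definition brick_wall_path (t : path_type) (s : seq point) : bool :=
  if s is p :: s' then path (step t) p s' && uniq s else false.

Definition in_rect (l w : nat) (p : point) : bool :=
  (0 <= p.1 <= l%:Z - 1) && (0 <= p.2 <= w%:Z - 1).

Definition no_vertical_left (t : path_type) (s : seq point) : bool :=
  sorted (fun p q : point => ~~ (vertical_step t p q && (p.1 == 0))) s.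

Definition admissible (t : path_type) (l w : nat) (s : seq point) : bool :=
  [&& brick_wall_path t s, all (in_rect l w) s,
      (head (0, 0) s).1 == 0 & no_vertical_left t s].

Lemma finite_admissible (t : path_type) (l w : nat) :
  finite_set [set s : seq point | admissible t l w s]%classic.
Proof.
pose emb (x : 'I_l * 'I_w) : point := (x.1%:Z, x.2%:Z).
pose B : set (seq point) :=
  ((fun b : {bseq #|{: 'I_l * 'I_w}| of 'I_l * 'I_w} => map emb b)
     @` setT)%classic.
apply: (@sub_finite_set _ _ B); last exact/finite_image/finite_finset.
move=> s /= /and4P[Hb Hr _ _].
have Hu : uniq s by case: s Hb {Hr} => //= a s /andP[].
have [r Er] : exists r : seq ('I_l * 'I_w), s = map emb r.
  elim: s Hr {Hb Hu} => [|[a b] s IHs] /=; first by exists [::].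
  move=> /andP[/andP[/= /andP[a0 al] /andP[b0 bw]] /IHs[r ->]].
  case: a a0 al => // a _ al; case: b b0 bw => // b _ bw.
  rewrite lerBrDr in al; rewrite lerBrDr in bw.
  have al' : (a < l)%N by rewrite -lez_nat -addn1 PoszD.
  have bw' : (b < w)%N by rewrite -lez_nat -addn1 PoszD.
  by exists ((Ordinal al', Ordinal bw') :: r).
have ur : uniq r by move: Hu; rewrite Er => /map_uniq.
have sr : (size r <= #|{: 'I_l * 'I_w}|)%N.
  by rewrite -(card_uniqP ur) max_card.
by exists (Bseq sr).
Qed.

(* [fset_set] is a junk value on infinite sets only; [finite_admissible] shows
   that the two cardinals below are genuine. *)
Definition num_paths (t : path_type) (l w : nat) : nat :=
  #|` fset_set [set s : seq point |
        admissible t l w s /\ (last (0, 0) s).1 = l%:Z - 1]%classic |.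

Definition num_paths_to (t : path_type) (l w i j : nat) : nat :=
  #|` fset_set [set s : seq point |
        admissible t l w s /\ last (0, 0) s = (i%:Z, j%:Z)]%classic |.

(* Entries are listed from height w - 1 down to height 0. *)
Definition path_vector (R : realType) (t : path_type) (l w i : nat) : 'cV[R]_w :=
  \col_(k < w) (num_paths_to t l w i (rev_ord k))%:R.

Definition Jmx (R : realType) : 'M[R]_2 := const_mx 1.

(* The block matrices have size \sum_(k < w./2) 2, resp.
   1 + (\sum_(k < (w - 2)./2) 2 + 1); [conform_mx] casts them to size w, which
   is the same number when w is even, resp. even and at least 2 (otherwise it
   returns 0). *)
Definition M_plus (R : realType) (w : nat) : 'M[R]_w :=
  conform_mx 0 (\mxdiag_(k < w./2) Jmx R).

Definition M_minus (R : realType) (w : nat) : 'M[R]_w :=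
  conform_mx 0
    (block_mx (1%:M : 'M[R]_1) 0 0
       (block_mx (\mxdiag_(k < (w - 2)./2) Jmx R) 0 0 (1%:M : 'M[R]_1))).

(* Main.v *)
(** Vertical steps follow a fixed-point-free involution of the lattice, so a
    path makes at most one vertical step in each column.  A path ending at
    [(i + 1, y)] therefore extends, horizontally, a path ending at [(i, y)], or,
    horizontally and then vertically, a path ending at [(i, y')], where [y'] is
    the height joined to [y] in column [i + 1], provided [y'] is in range.  In
    matrix form this is multiplication by [M_-] or [M_+], alternating with the
    parity of the column. *)
From mathcomp Require Import finmap boolp classical_sets cardinality zify.
Require Import Defs.
From mathcomp Require Import all_boot all_order all_algebra.
From mathcomp Require Import reals.

Import Order.TTheory GRing.Theory Num.Theory.
Local Open Scope ring_scope.

(** * Vertical moves in the brick wall *)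

Definition goes_up (t : path_type) (p : point) : bool :=
  if t is FirstType then even_point p else odd_point p.

(** Exactly one vertical step leaves each point, so a function can replace the relation
    [vertical_step t]. *)
Definition vertical_move (t : path_type) (p : point) : point :=
  if goes_up t p then (p.1, p.2 + 1) else (p.1, p.2 - 1).

Lemma vertical_stepE t p q : vertical_step t p q = (q == vertical_move t p).
Proof.
by rewrite /vertical_step /vertical_move /goes_up /even_point;
  case: t; rewrite /odd_point; case: (odd _) => //=; rewrite ?orbF.
Qed.

Lemma vertical_move1 t p : (vertical_move t p).1 = p.1.
Proof. by rewrite /vertical_move; case: ifP. Qed.

Lemma odd_abszD1 (y : int) : odd (absz (y + 1)) = ~~ odd (absz y).
Proof. lia. Qed.

Lemma odd_abszB1 (y : int) : odd (absz (y - 1)) = ~~ odd (absz y).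
Proof. lia. Qed.

(** A vertical move changes the parity of the point, and the direction depends on that parity
    alone. *)
Lemma goes_up_vertical_move t p :
  goes_up t (vertical_move t p) = ~~ goes_up t p.
Proof.
case: p => x y; rewrite /vertical_move /goes_up /even_point /odd_point.
by case: t => /=; case: ifP => /=;
  rewrite !oddD ?odd_abszD1 ?odd_abszB1 ?addbN /= => ->.
Qed.

Lemma vertical_moveK t : involutive (vertical_move t).
Proof.
move=> [x y]; rewrite {1}/vertical_move goes_up_vertical_move /vertical_move.
by case: (goes_up t _) => /=; rewrite ?addrK ?subrK.
Qed.

Lemma vertical_move_neq t p : vertical_move t p != p.
Proof.
apply/eqP=> /(congr1 snd); case: p => x y.
by rewrite /vertical_move; case: ifP => /=; lia.
Qed.

Lemma horizontal_stepP (p q : point) :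
  reflect (q.1 = p.1 + 1 /\ q.2 = p.2) (horizontal_step p q).
Proof.
rewrite /horizontal_step; case: p q => [x y] [x' y'].
by apply: (iffP eqP) => [[-> ->]|[/= -> ->]].
Qed.

Lemma step_abscissa_le t (p q : point) : step t p q -> p.1 <= q.1.
Proof.
case/orP=> [/horizontal_stepP[-> _]|]; first lia.
by rewrite vertical_stepE => /eqP ->; rewrite vertical_move1.
Qed.

(** * Admissible paths classified by their last steps *)

Definition endpoint (s : seq point) : point := last (0, 0) s.

Lemma endpoint_rcons s p : endpoint (rcons s p) = p.
Proof. exact: last_rcons. Qed.

Lemma mem_endpoint s : s != [::] -> endpoint s \in s.
Proof. by case: s => // a s _; rewrite /endpoint /= mem_last. Qed.

Lemma admissible_rcons t l w s q : s != [::] ->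
  admissible t l w (rcons s q) =
    [&& admissible t l w s, in_rect l w q, step t (endpoint s) q, q \notin s
      & ~~ (vertical_step t (endpoint s) q && ((endpoint s).1 == 0))].
Proof.
case: s => // a s _; rewrite /endpoint /admissible /no_vertical_left /= !rcons_path.
rewrite rcons_uniq mem_rcons all_rcons !inE negb_or eq_sym negb_or.
case: (path (step t) a s); case: (path _ a s); case: (step t _ q) => //=;
  case: (a \notin s); case: (q != a) => //=; rewrite ?andbF //=;
  case: (q \notin s) => //=; rewrite ?andbF //=; case: (uniq s) => //=;
  case: (in_rect l w a) => //=; case: (in_rect l w q) => //=;
  by case: (all _ s); case: (a.1 == 0).
Qed.

Lemma admissible_neq_nil t l w s : admissible t l w s -> s != [::].
Proof. by case: s. Qed.

Lemma admissible_in_rect t l w s : admissible t l w s -> all (in_rect l w) s.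
Proof. by case/and4P. Qed.

Lemma admissible_endpoint_in_rect t l w s :
  admissible t l w s -> in_rect l w (endpoint s).
Proof.
move=> sA; apply: (allP (admissible_in_rect _ _ _ _ sA)).
exact/mem_endpoint/(admissible_neq_nil _ _ _ _ sA).
Qed.

(** Neither kind of step decreases the abscissa. Hence a point to the right of the endpoint has not
    been visited. *)
Lemma admissible_abscissa_le t l w s (p : point) :
  admissible t l w s -> p \in s -> p.1 <= (endpoint s).1.
Proof.
elim/last_ind: s p => // s q IHs p; have [-> _|s0] := eqVneq s [::].
  by rewrite inE => /eqP ->.
rewrite admissible_rcons // endpoint_rcons => /and5P[sA _ st _ _].
rewrite mem_rcons inE => /predU1P[-> //|ps].
exact: le_trans (IHs p sA ps) (step_abscissa_le _ _ _ st).
Qed.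

(* The paths from the left side to [(i, y)], for [i < l] and [0 <= y < w]. *)
Fixpoint paths_to t (w i : nat) (y : int) : seq (seq point) :=
  if i is i'.+1 then
    let q : point := (i%:Z, y) in
    let q' := vertical_move t q in
    [seq rcons s q | s <- paths_to t w i' y] ++
    (if 0 <= q'.2 <= w%:Z - 1
     then [seq rcons (rcons s q') q | s <- paths_to t w i' q'.2] else [::])
  else [:: [:: (0, y)]].

Lemma admissible_rcons_horizontal t l w s (p : point) :
  admissible t l w s -> in_rect l w p -> p.1 = (endpoint s).1 + 1 ->
  p.2 = (endpoint s).2 -> admissible t l w (rcons s p).
Proof.
move=> sA pR p1 p2.
rewrite admissible_rcons ?(admissible_neq_nil _ _ _ _ sA) // sA pR /=.
apply/and3P; split.
- by apply/orP; left; apply/horizontal_stepP.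
- by apply/negP=> /(admissible_abscissa_le _ _ _ _ _ sA); lia.
- rewrite vertical_stepE; apply/negP=> /andP[/eqP E _].
  by move: p1; rewrite E vertical_move1; lia.
Qed.

(** A last step would come from abscissa -1, outside the rectangle, or run along the forbidden left
    side. *)
Lemma admissible_abscissa0 t l w s : admissible t l w s ->
  (endpoint s).1 = 0 -> s = [:: endpoint s].
Proof.
case/lastP: s => [//|s q]; have [-> //|s0] := eqVneq s [::].
rewrite endpoint_rcons admissible_rcons // => /and5P[sA _ st _ nv] q1.
have /andP[] := admissible_endpoint_in_rect _ _ _ _ sA.
case/orP: st => [/horizontal_stepP[]|]; first by lia.
move=> st; rewrite st /= in nv; move: st; rewrite vertical_stepE => /eqP E.
by move: nv; rewrite -(vertical_move1 t) -E q1.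
Qed.

(* Two vertical steps in a row would return to the starting point. *)
Lemma admissible_rcons2 t l w s (p q : point) :
    s != [::] -> vertical_step t p q -> admissible t l w (rcons (rcons s p) q) ->
  admissible t l w s /\ horizontal_step (endpoint s) p.
Proof.
rewrite vertical_stepE => s0 /eqP E.
rewrite admissible_rcons; last by case: (s).
move=> /and5P[+ _ _ qs _]; rewrite admissible_rcons // => /and5P[sA _ + _ _].
case/orP=> // ; rewrite vertical_stepE => /eqP E'; case/negP: qs.
by rewrite E E' vertical_moveK mem_rcons inE mem_endpoint ?orbT.
Qed.

Lemma mem_paths_to t l w i (y : int) (s : seq point) :
    (i < l)%N -> 0 <= y <= w%:Z - 1 ->
  (s \in paths_to t w i y) = admissible t l w s && (endpoint s == (i%:Z, y)).
Proof.
elim: i y s => [|i IHi] y s il yw.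
  rewrite inE; apply/eqP/andP=> [->|[sA /eqP E]].
    rewrite /admissible /= /no_vertical_left /in_rect /= yw eqxx.
    by split=> //; lia.
  by rewrite (admissible_abscissa0 _ _ _ _ sA) E.
have il' : (i < l)%N by lia.
rewrite [paths_to _ _ _ _]/= mem_cat.
set q : point := (_, y); set q' := vertical_move t q.
have q'1 : q'.1 = i.+1%:Z by rewrite vertical_move1.
have qR : in_rect l w q by rewrite /in_rect /= yw; lia.
apply/orP/andP => [[/mapP[s']|]|].
- rewrite IHi // => /andP[s'A /eqP s'L] ->; rewrite endpoint_rcons eqxx.
  by split=> //; apply: admissible_rcons_horizontal; rewrite // s'L //=; lia.
- case: ifP => // q'w /mapP[s']; rewrite IHi // => /andP[s'A /eqP s'L] ->.
  rewrite endpoint_rcons eqxx; split=> //.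
  have q'R : in_rect l w q' by rewrite /in_rect q'1 q'w; lia.
  have s''A : admissible t l w (rcons s' q').
    by apply: admissible_rcons_horizontal; rewrite // s'L //= q'1; lia.
  rewrite admissible_rcons ?(admissible_neq_nil _ _ _ _ s''A) // s''A qR.
  (* The step from [q'] leads back to [q] because the vertical move is an involution. *)
  rewrite endpoint_rcons /step vertical_stepE vertical_moveK eqxx orbT /=.
  rewrite mem_rcons inE q'1 andbT negb_or eq_sym vertical_move_neq /=.
  by apply/negP=> /(admissible_abscissa_le _ _ _ _ _ s'A); rewrite s'L /=; lia.
case/lastP: s => [[]//|s p]; rewrite endpoint_rcons => -[sA /eqP pq].
move: sA; rewrite {}pq; have [->|s0] := eqVneq s [::].
  by case/and4P=> _ _ /= /eqP.
move=> sqA; move: (sqA); rewrite admissible_rcons // => /and5P[sA _ st _ _].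
case/orP: st => [/horizontal_stepP[/= E1 E2]|st].
  left; apply: map_f; rewrite IHi // sA [endpoint s]surjective_pairing -E2.
  by rewrite xpair_eqE eqxx andbT; apply/eqP; lia.
right; have /andP[_ q'w] := admissible_endpoint_in_rect _ _ _ _ sA.
have sL : endpoint s = q'.
  by move: st; rewrite vertical_stepE /q' => /eqP ->; rewrite vertical_moveK.
rewrite sL in q'w st; rewrite q'w.
case/lastP: s => // s r in s0 sqA sA sL *.
rewrite endpoint_rcons in sL; subst r.
apply: (map_f (fun s => rcons (rcons s q') q)); rewrite IHi //.
(* A path reduced to [q'] would start in column [i.+1] instead of on the left side. *)
move: sA; have [->|s'0] := eqVneq s [::].
  by case/and4P=> _ _ /= /eqP E; move: q'1; rewrite E.
move=> _; have [sA /horizontal_stepP[E1 E2]] := admissible_rcons2 _ _ _ _ _ _ s'0 st sqA.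
rewrite sA [endpoint s]surjective_pairing -E2 xpair_eqE eqxx andbT.
by apply/eqP; lia.
Qed.

Lemma paths_to_uniq t w i (y : int) : 0 <= y <= w%:Z - 1 -> uniq (paths_to t w i y).
Proof.
elim: i y => // i IHi y yw; rewrite [paths_to _ _ _ _]/= cat_uniq.
set q : point := (_, y); set q' := vertical_move t q.
rewrite map_inj_uniq ?IHi //=; last exact: rcons_injl.
case: ifP => //= q'w; rewrite map_inj_uniq ?IHi ?andbT //=; last first.
  by move=> s1 s2 /= /rcons_inj[/rcons_inj[]].
(* A path in both lists would have its penultimate point both in column [i] and in column [i.+1]. *)
apply/hasPn=> _ /mapP[s1 _ ->]; apply/negP=> /mapP[s2 s2P /rcons_inj[E]].
(* [paths_to] does not depend on [l]; [i.+1] is the least length whose rectangle contains column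
   [i]. *)
move: s2P; rewrite (@mem_paths_to _ i.+1) // -E endpoint_rcons => /andP[_ /eqP E'].
have := vertical_move1 t q; rewrite -/q' E' /=; lia.
Qed.

(** * Path counts as sizes of duplicate-free lists *)

Lemma fset_set_uniq (T : choiceType) (A : set T) (s : seq T) :
  uniq s -> (forall x, A x <-> x \in s) -> #|` fset_set A| = size s.
Proof.
(* The list also gives finiteness, without which [fset_set] would be a junk value. *)
move=> us As; have -> : A = [set` [fset x in s]%fset]%classic.
  by apply/seteqP; split=> x /=; rewrite in_fset As.
by rewrite set_fsetK card_fseq undup_id.
Qed.

Lemma num_paths_toE t l w i j : (i < l)%N -> (j < w)%N ->
  num_paths_to t l w i j = size (paths_to t w i j%:Z).
Proof.
move=> il jw; have jw' : 0 <= j%:Z <= w%:Z - 1 by lia.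
apply: fset_set_uniq => [|s]; first exact: paths_to_uniq.
rewrite (mem_paths_to _ l) //; split=> [[/= sA E]|/andP[sA /eqP E]] //.
by rewrite sA; apply/eqP.
Qed.

Lemma num_pathsE t l w : (0 < l)%N ->
  num_paths t l w = (\sum_(j < w) num_paths_to t l w (l - 1) j)%N.
Proof.
move=> l0; have l1 : (l - 1 < l)%N by lia.
pose P (j : 'I_w) := paths_to t w (l - 1) j%:Z.
have memP (j : 'I_w) s : s \in P j =
    admissible t l w s && (endpoint s == ((l - 1)%N%:Z, j%:Z)).
  by apply: mem_paths_to => //; have := ltn_ord j; lia.
rewrite /num_paths (@fset_set_uniq _ _ [seq s | j <- enum 'I_w, s <- P j]).
- rewrite size_allpairs_dep sumnE big_map big_enum /=.
  by apply: eq_bigr => j _; rewrite num_paths_toE.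
- apply: allpairs_uniq_dep; first exact: enum_uniq.
    by move=> j _; apply: paths_to_uniq; have := ltn_ord j; lia.
  move=> _ _ /allpairsPdep[j [s [_ sj ->]]] /allpairsPdep[k [r [_ rk ->]]] /=.
  move=> E; rewrite -{}E in rk *; congr existT.
  (* Both heights are the ordinate of the endpoint of the same path. *)
  move: sj rk; rewrite !memP => /andP[_ /eqP ->] /andP[_ /eqP[]] E.
  by apply/val_inj.
move=> s /=; split=> [[sA sL]|/allpairsPdep[j [r [_ rP ->]]]]; last first.
  move: rP; rewrite memP => /andP[rA /eqP rE]; split=> //.
  by rewrite -/(endpoint r) rE /=; lia.
have := admissible_endpoint_in_rect _ _ _ _ sA; rewrite -/(endpoint s) in sL.
case E: (endpoint s) sL => [x [y|y]] /= xl; rewrite /in_rect /=; last lia.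
move=> yw; have yw' : (y < w)%N by lia.
apply/allpairsPdep; exists (Ordinal yw'), s; split=> //; first by rewrite mem_enum.
by rewrite memP sA E xl xpair_eqE eqxx andbT /=; lia.
Qed.

(** * Entries of the block matrices *)

Lemma conform_mx_cast (V : Type) (m n : nat) (e : m = n) (A : 'M[V]_n)
    (B : 'M[V]_m) i j :
  conform_mx A B i j = B (cast_ord (esym e) i) (cast_ord (esym e) j).
Proof. by case: n / e A i j => A i j; rewrite conform_mx_id !cast_ord_id. Qed.

Lemma tagnat_sig1_half n (i : 'I_(\sum_(k < n) 2)) : tagnat.sig1 i = i./2 :> nat.
Proof.
rewrite -[in RHS](tagnat.sigK i) tagnat.rankEsum /tagnat.sig1.
case: (tagnat.sig i) => /= k r.
(* Entry [r] of block [k] has index [2k + r], with [r < 2]. *)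
by rewrite (big_ord_narrow (ltnW (ltn_ord k))) sum_nat_const card_ord;
  have := ltn_ord r; lia.
Qed.

Lemma mxdiag_JmxE (R : realType) n (i j : 'I_(\sum_(k < n) 2)) :
  (\mxdiag_(k < n) Jmx R) i j = (i./2 == j./2)%:R.
Proof.
rewrite /mxdiag /mxblock mxE -!tagnat_sig1_half -val_eqE.
by case: eqP => _; rewrite ?conform_mx_id mxE.
Qed.

Lemma M_plusE (R : realType) w (i j : 'I_w) :
  ~~ odd w -> M_plus R w i j = (i./2 == j./2)%:R.
Proof.
move=> w_even; have e : (\sum_(k < w./2) 2 = w)%N.
  by rewrite sum_nat_const card_ord; lia.
by rewrite /M_plus (conform_mx_cast _ _ _ e) mxdiag_JmxE.
Qed.

(** The leading 1 shifts the blocks by one place, so [uphalf] numbers them: [0] and [w - 1] stand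
    alone, and [2k - 1] shares a block with [2k]. *)
Lemma M_minusE (R : realType) w (i j : 'I_w) : (2 <= w)%N ->
  ~~ odd w -> M_minus R w i j = (uphalf i == uphalf j)%:R.
Proof.
move=> w2 w_even; have s : (\sum_(k < (w - 2)./2) 2 = w - 2)%N.
  by rewrite sum_nat_const card_ord; lia.
have e : (1 + (\sum_(k < (w - 2)./2) 2 + 1) = w)%N by lia.
rewrite /M_minus; move: (mxdiag_JmxE R (w - 2)./2); move: (mxdiag _).
move: (\sum_(k < (w - 2)./2) 2)%N s e => S s e D DE.
have off_diag (b : bool) : ~~ b -> 0 = b%:R :> R by move/negPf ->.
rewrite (conform_mx_cast _ _ _ e) !mxE.
case: splitP => i' /= ->; rewrite !mxE; case: splitP => j' /= ->; rewrite !mxE.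
- by rewrite !ord1.
- by apply: off_diag; move: (ltn_ord i') (ltn_ord j'); lia.
- by apply: off_diag; move: (ltn_ord i') (ltn_ord j'); lia.
case: splitP => i'' /= ->; rewrite !mxE; case: splitP => j'' /= ->; rewrite ?mxE.
- by rewrite DE; congr (_%:R); lia.
- by apply: off_diag; move: (ltn_ord i'') (ltn_ord j''); lia.
- by apply: off_diag; move: (ltn_ord i'') (ltn_ord j''); lia.
- by rewrite !ord1 !eqxx.
Qed.

(* Up-steps of column [x] start at even heights exactly when one starts at height
   0; the blocks [J] then join the heights 2k and 2k + 1. *)
Definition column_matrix (R : realType) (t : path_type) (w x : nat) : 'M[R]_w :=
  if goes_up t (x%:Z, 0) then M_plus R w else M_minus R w.

Lemma column_matrix_even (R : realType) t w k :
  column_matrix R t w k.*2 = column_matrix R t w 0.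
Proof.
by rewrite /column_matrix /goes_up /even_point /odd_point /= !addn0 odd_double.
Qed.

Lemma column_matrix_odd (R : realType) t w k :
  column_matrix R t w k.*2.+1 = column_matrix R t w 1.
Proof.
by rewrite /column_matrix /goes_up /even_point /odd_point /= !addn0 odd_double.
Qed.

(** Since [w] is even, reversing the indices maps blocks to blocks, so indices in one block are
    heights joined by a vertical edge. A move out of range matches no [j], which accounts for the
    end blocks of [M_minus]. *)
Lemma column_matrixE (R : realType) t w x (i j : 'I_w) :
    (2 <= w)%N -> ~~ odd w ->
  column_matrix R t w x i j =
    ((j == i) || ((rev_ord j)%:Z == (vertical_move t (x%:Z, (rev_ord i)%:Z)).2))%:R.
Proof.
move=> w2 w_even; have [ilt jlt] := (ltn_ord i, ltn_ord j).
(* Directions alternate along a column, so the direction at height 0 fixes all of them. *)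
have up (y : nat) : goes_up t (x%:Z, y%:Z) = goes_up t (x%:Z, 0) (+) odd y.
  by case: (t); rewrite /= /even_point /odd_point /= addn0 oddD ?addNb.
rewrite /column_matrix /vertical_move up -val_eqE.
case: (goes_up _ _) => /=; rewrite ?M_plusE ?M_minusE //; congr (_%:R).
  by case: ifP => /= o; lia.
by case: ifP => /= o; lia.
Qed.

(** * The recurrence on path vectors *)

Lemma path_vectorS (R : realType) t l w i :
    (i.+1 < l)%N -> (2 <= w)%N -> ~~ odd w ->
  path_vector R t l w i.+1 =
    column_matrix R t w i.+1 *m path_vector R t l w i.
Proof.
move=> il w2 w_even; apply/colP=> k; rewrite !mxE num_paths_toE ?ltn_ord //=.
rewrite size_cat size_map natrD.
set q : point := (_, _); set q' := vertical_move t q.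
pose f y : R := (size (paths_to t w i y))%:R.
transitivity (\sum_(j < w) ((j == k) || ((rev_ord j)%:Z == q'.2))%:R *
  f (rev_ord j)%:Z); last first.
  apply: eq_bigr => j _; rewrite column_matrixE // mxE num_paths_toE //.
  by apply: ltnW.
(* The diagonal term counts the paths whose last step is horizontal. *)
rewrite (bigD1 k) //= eqxx mul1r; congr (_ + _).
case: ifP => q'w; last first.
  (* With the partner height out of range, row [k] has only its diagonal entry. *)
  rewrite big1 // => j /negPf ->; case: eqP => /= E; rewrite ?mul0r //.
  by move: q'w; rewrite -E; have := ltn_ord j; lia.
have q'lt : (absz q'.2 < w)%N by lia.
have rk' : (rev_ord (rev_ord (Ordinal q'lt)))%:Z = q'.2.
  by rewrite rev_ordK /=; lia.
(* The column of height [q'.2] counts the paths whose last step is vertical; it differs from [k]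
   because a vertical move fixes no point. *)
rewrite (bigD1 (rev_ord (Ordinal q'lt))) /=; last first.
  apply/eqP => E; move: rk'; rewrite E => E'.
  have := vertical_move_neq t q; rewrite -/q' [q']surjective_pairing -E'.
  by rewrite vertical_move1 eqxx.
rewrite rk' eqxx orbT mul1r size_map big1 ?addr0 // => j /andP[/negPf -> jk'].
case: eqP => /= E; rewrite ?mul0r //; case/eqP: jk'.
exact/(can_inj rev_ordK)/val_inj/(congr1 absz (etrans E (esym rk'))).
Qed.

Lemma path_vector0 (R : realType) t l w : (0 < l)%N ->
  path_vector R t l w 0 = const_mx 1.
Proof. by move=> l0; apply/colP=> k; rewrite !mxE num_paths_toE. Qed.

(** Each factor accounts for an odd column and the even column after it. Column 0 itself contributes
    only the all-ones vector; its matrix stands for the later even columns. *)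
Lemma path_vector_double (R : realType) t l w k :
    (k.*2 < l)%N -> (2 <= w)%N -> ~~ odd w ->
  path_vector R t l w k.*2 =
    (column_matrix R t w 0 *m column_matrix R t w 1) ^+ k *m const_mx 1.
Proof.
move=> kl w2 w_even; elim: k kl => [|k IHk] kl.
  by rewrite path_vector0 // expr0 mul1mx.
rewrite doubleS !path_vectorS //; try lia.
rewrite IHk; last lia.
by rewrite exprS -mulmxE -!mulmxA column_matrix_odd -doubleS column_matrix_even.
Qed.

Lemma path_vector_last (R : realType) t l w :
    (2 <= l)%N -> (2 <= w)%N -> ~~ odd w ->
  let A := column_matrix R t w 1 in
  let B := column_matrix R t w 0 in
  let rho := ((l - 1) %/ 2)%N in
  path_vector R t l w (l - 1) =
    if odd l then (B *m A) ^+ rho *m const_mx 1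
    else A *m (B *m A) ^+ rho *m const_mx 1.
Proof.
move=> l2 w2 w_even A B rho; case: ifP => l_odd.
  have e : (l - 1 = rho.*2)%N by rewrite /rho; lia.
  by rewrite e path_vector_double //; lia.
have e : (l - 1 = rho.*2.+1)%N by rewrite /rho; lia.
rewrite e path_vectorS //; last lia.
by rewrite path_vector_double -?mulmxA ?column_matrix_odd //; lia.
Qed.

Lemma num_paths_sum (R : realType) t l w : (0 < l)%N ->
  (num_paths t l w)%:R = ((const_mx 1 : 'rV[R]_w) *m path_vector R t l w (l - 1)) 0 0.
Proof.
move=> l0; rewrite num_pathsE // mxE natr_sum.
rewrite (reindex_inj rev_ord_inj) /=.
by apply: eq_bigr => j _; rewrite !mxE mul1r.
Qed.

Theorem theorem2p4 (R : realType) (l w : nat)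
    (hl : (2 <= l)%N) (hw : (2 <= w)%N) (w_even : ~~ odd w) :
  let u : 'rV[R]_w := const_mx 1 in
  let b0 : 'cV[R]_w := const_mx 1 in
  let rho := ((l - 1) %/ 2)%N in
  let Mp : 'M[R]_w := M_plus R w in
  let Mm : 'M[R]_w := M_minus R w in
  let b1 : 'cV[R]_w := path_vector R FirstType l w (l - 1) in
  let b2 : 'cV[R]_w := path_vector R SecondType l w (l - 1) in
  ((num_paths FirstType l w)%:R = (u *m b1) 0 0 /\
   b1 = (if odd l then (Mp *m Mm) ^+ rho *m b0
         else Mm *m (Mp *m Mm) ^+ rho *m b0)) /\
  ((num_paths SecondType l w)%:R = (u *m b2) 0 0 /\
   b2 = (if odd l then (Mm *m Mp) ^+ rho *m b0
         else Mp *m (Mm *m Mp) ^+ rho *m b0)).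
Proof.
have l0 := ltnW hl.
(* The origin is even, so column 0 has matrix [M_plus] and column 1 has [M_minus] for the first
   type, and conversely for the second; both are found by computation. *)
by split; split; rewrite ?num_paths_sum //; apply: path_vector_last.
Qed.
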